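(* Let $r\ge 1$ and let $t,u\ge 0$ be integers with $t+u\ge 1$. If the pseudo $H$-type Lie algebra $\mathfrak n_{r,0}$ is isomorphic, as a Lie algebra, to $\mathfrak n_{t,u}$, then $(t,u)=(r,0)$ or $(t,u)=(0,r)$. In other words, the only pseudo $H$-type Lie algebra $\mathfrak n_{t,u}$ other than $\mathfrak n_{r,0}$ itself to which $\mathfrak n_{r,0}$ can be isomorphic is $\mathfrak n_{0,r}$.
   Context: For integers $r,s\ge 0$ with $r+s\ge1$, $\mathbb R^{r,s}$ is $\mathbb R^{r+s}$ with $\langle Z,W\rangle_{r,s}=\sum_{i=1}^r Z_iW_i-\sum_{j=r+1}^{r+s}Z_jW_j$, and $\mathrm{Cl}_{r,s}$ is the real unital associative algebra generated by $\mathbb R^{r,s}$ subject to $Z\otimes Z=-\langle Z,Z\rangle_{r,s}\,1$. A scalar product is a non-degenerate (possibly indefinite) symmetric bilinear form. An admissible $\mathrm{Cl}_{r,s}$-module is a non-zero finite-dimensional real vector space $\mathfrak v$ with a representation $J:\mathrm{Cl}_{r,s}\to\mathrm{End}(\mathfrak v)$ and a scalar product $\langle\cdot,\cdot\rangle_{\mathfrak v}$ such that $\langle J_Zv,w\rangle_{\mathfrak v}=-\langle v,J_Zw\rangle_{\mathfrak v}$ for all $Z\in\mathbb R^{r,s}$, $v,w\in\mathfrak v$. It is minimal if its dimension is minimal among admissible $\mathrm{Cl}_{r,s}$-modules. The associated pseudo $H$-type Lie algebra is $\mathfrak n=\mathfrak v\oplus\mathbb R^{r,s}$ (orthogonal sum),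 with center $\mathbb R^{r,s}$ and bracket $[\cdot,\cdot]:\mathfrak v\times\mathfrak v\to\mathbb R^{r,s}$ determined by $\langle J_Zv,w\rangle_{\mathfrak v}=\langle Z,[v,w]\rangle_{r,s}$ for all $Z\in\mathbb R^{r,s}$, $v,w\in\mathfrak v$. The notation $\mathfrak n_{r,s}=\mathfrak v_{r,s}\oplus\mathfrak z_{r,s}$, $\mathfrak z_{r,s}=\mathbb R^{r,s}$, stands for the pseudo $H$-type Lie algebra built from a minimal admissible module $\mathfrak v_{r,s}$ (for $s=0$ the scalar product on $\mathfrak v_{r,0}$ is positive definite). Isomorphisms are isomorphisms of Lie algebras, with no condition on scalar products. *)

(* Defs.v *)
From HB Require Import structures.
From mathcomp Require Import all_boot all_order all_algebra.
From mathcomp Require Import boolp reals.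

Set Implicit Arguments.
Unset Strict Implicit.
Unset Printing Implicit Defensive.

Import Order.TTheory GRing.Theory Num.Theory.

Local Open Scope ring_scope.
Local Open Scope quotient_scope.

(* R^{r,s} is the row space 'rV[R]_(r + s) with the following form. *)
Definition rs_form (R : realType) (r s : nat) (Z W : 'rV[R]_(r + s)) : R :=
  \sum_(i < r) Z 0 (lshift s i) * W 0 (lshift s i)
  - \sum_(j < s) Z 0 (rshift r j) * W 0 (rshift r j).

(* Cl_{r,s} is built by generators and relations: formal expressions in the
   vectors of R^{r,s}, modulo the smallest congruence that satisfies the axioms
   of a unital associative R-algebra, the linearity of R^{r,s} -> Cl_{r,s}, and
   Z * Z = - <Z, Z>_{r,s} 1. *)
Section CliffordAlgebra.
Variables (R : realType) (r s : nat).

Inductive cliff_expr : Type :=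
  | CliffGen of 'rV[R]_(r + s)
  | CliffZero
  | CliffOne
  | CliffAdd of cliff_expr & cliff_expr
  | CliffScale of R & cliff_expr
  | CliffMul of cliff_expr & cliff_expr.

Inductive cliff_eq : cliff_expr -> cliff_expr -> Prop :=
  | cliff_refl x : cliff_eq x x
  | cliff_sym x y : cliff_eq x y -> cliff_eq y x
  | cliff_trans x y z : cliff_eq x y -> cliff_eq y z -> cliff_eq x z
  | cliff_congrD x x' y y' : cliff_eq x x' -> cliff_eq y y' ->
      cliff_eq (CliffAdd x y) (CliffAdd x' y')
  | cliff_congrZ a x x' : cliff_eq x x' ->
      cliff_eq (CliffScale a x) (CliffScale a x')
  | cliff_congrM x x' y y' : cliff_eq x x' -> cliff_eq y y' ->
      cliff_eq (CliffMul x y) (CliffMul x' y')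
  | cliff_addA x y z :
      cliff_eq (CliffAdd x (CliffAdd y z)) (CliffAdd (CliffAdd x y) z)
  | cliff_addC x y : cliff_eq (CliffAdd x y) (CliffAdd y x)
  | cliff_add0 x : cliff_eq (CliffAdd CliffZero x) x
  | cliff_scale0 x : cliff_eq (CliffScale 0 x) CliffZero
  | cliff_scale1 x : cliff_eq (CliffScale 1 x) x
  | cliff_scaleA a b x :
      cliff_eq (CliffScale a (CliffScale b x)) (CliffScale (a * b) x)
  | cliff_scaleDr a x y :
      cliff_eq (CliffScale a (CliffAdd x y))
               (CliffAdd (CliffScale a x) (CliffScale a y))
  | cliff_scaleDl a b x :
      cliff_eq (CliffScale (a + b) x)
               (CliffAdd (CliffScale a x) (CliffScale b x))
  | cliff_mulA x y z :
      cliff_eq (CliffMul x (CliffMul y z)) (CliffMul (CliffMul x y) z)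
  | cliff_mul1l x : cliff_eq (CliffMul CliffOne x) x
  | cliff_mul1r x : cliff_eq (CliffMul x CliffOne) x
  | cliff_mulDl x y z :
      cliff_eq (CliffMul (CliffAdd x y) z)
               (CliffAdd (CliffMul x z) (CliffMul y z))
  | cliff_mulDr x y z :
      cliff_eq (CliffMul x (CliffAdd y z))
               (CliffAdd (CliffMul x y) (CliffMul x z))
  | cliff_scaleAl a x y :
      cliff_eq (CliffScale a (CliffMul x y)) (CliffMul (CliffScale a x) y)
  | cliff_scaleAr a x y :
      cliff_eq (CliffScale a (CliffMul x y)) (CliffMul x (CliffScale a y))
  | cliff_genP a Z W :
      cliff_eq (CliffGen (a *: Z + W))
               (CliffAdd (CliffScale a (CliffGen Z)) (CliffGen W))
  | cliff_square Z :
      cliff_eq (CliffMul (CliffGen Z) (CliffGen Z))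
               (CliffScale (- rs_form Z Z) CliffOne).

HB.instance Definition _ := gen_eqMixin cliff_expr.
HB.instance Definition _ := gen_choiceMixin cliff_expr.

Definition cliff_rel : rel cliff_expr := fun x y => `[< cliff_eq x y >].

Lemma cliff_rel_refl : reflexive cliff_rel.
Proof. by move=> x; apply/asboolP; exact: cliff_refl. Qed.

Lemma cliff_rel_sym : symmetric cliff_rel.
Proof. by move=> x y; apply/asboolP/asboolP; exact: cliff_sym. Qed.

Lemma cliff_rel_trans : transitive cliff_rel.
Proof.
by move=> y x z /asboolP xy /asboolP yz; apply/asboolP; exact: cliff_trans yz.
Qed.

Canonical cliff_equiv :=
  EquivRel cliff_rel cliff_rel_refl cliff_rel_sym cliff_rel_trans.

Definition Cl := {eq_quot cliff_equiv}.

HB.instance Definition _ := Choice.on Cl.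

Definition Cl_class (x : cliff_expr) : Cl := \pi_({eq_quot cliff_equiv}) x.
Definition Cl_repr (x : Cl) : cliff_expr := repr (x : {eq_quot cliff_equiv}).

Lemma Cl_classP x y : Cl_class x = Cl_class y <-> cliff_eq x y.
Proof.
by split=> [/eqmodP/asboolP //|xy]; apply/eqmodP/asboolP.
Qed.

Lemma Cl_reprK x : Cl_class (Cl_repr x) = x.
Proof. exact: reprK. Qed.

Lemma Cl_repr_class x : cliff_eq (Cl_repr (Cl_class x)) x.
Proof. by apply/Cl_classP; rewrite Cl_reprK. Qed.

Lemma Cl_classW (P : Cl -> Prop) : (forall x, P (Cl_class x)) -> forall x, P x.
Proof. by move=> Px x; rewrite -(Cl_reprK x). Qed.

Definition Cl_zero : Cl := Cl_class CliffZero.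
Definition Cl_one : Cl := Cl_class CliffOne.
Definition Cl_add (x y : Cl) : Cl :=
  Cl_class (CliffAdd (Cl_repr x) (Cl_repr y)).
Definition Cl_scale (a : R) (x : Cl) : Cl :=
  Cl_class (CliffScale a (Cl_repr x)).
Definition Cl_opp (x : Cl) : Cl := Cl_scale (-1) x.
Definition Cl_mul (x y : Cl) : Cl :=
  Cl_class (CliffMul (Cl_repr x) (Cl_repr y)).
Definition Cl_gen (Z : 'rV[R]_(r + s)) : Cl := Cl_class (CliffGen Z).

Lemma Cl_addE x y : Cl_add (Cl_class x) (Cl_class y) = Cl_class (CliffAdd x y).
Proof. by apply/Cl_classP/cliff_congrD; exact: Cl_repr_class. Qed.

Lemma Cl_scaleE a x : Cl_scale a (Cl_class x) = Cl_class (CliffScale a x).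
Proof. by apply/Cl_classP/cliff_congrZ; exact: Cl_repr_class. Qed.

Lemma Cl_mulE x y : Cl_mul (Cl_class x) (Cl_class y) = Cl_class (CliffMul x y).
Proof. by apply/Cl_classP/cliff_congrM; exact: Cl_repr_class. Qed.

Let ClE := (Cl_addE, Cl_scaleE, Cl_mulE).

Lemma Cl_addA : associative Cl_add.
Proof.
by elim/Cl_classW=> x; elim/Cl_classW=> y; elim/Cl_classW=> z; rewrite !ClE;
   apply/Cl_classP; exact: cliff_addA.
Qed.

Lemma Cl_addC : commutative Cl_add.
Proof.
by elim/Cl_classW=> x; elim/Cl_classW=> y; rewrite !ClE;
   apply/Cl_classP; exact: cliff_addC.
Qed.

Lemma Cl_add0 : left_id Cl_zero Cl_add.
Proof.
by elim/Cl_classW=> x; rewrite !ClE; apply/Cl_classP;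
  exact: cliff_add0.
Qed.

Lemma Cl_scale1 : left_id 1 Cl_scale.
Proof.
by elim/Cl_classW=> x; rewrite !ClE; apply/Cl_classP;
  exact: cliff_scale1.
Qed.

Lemma Cl_scaleA a b x : Cl_scale a (Cl_scale b x) = Cl_scale (a * b) x.
Proof.
by elim/Cl_classW: x => x; rewrite !ClE; apply/Cl_classP;
  exact: cliff_scaleA.
Qed.

Lemma Cl_scaleDr : right_distributive Cl_scale Cl_add.
Proof.
by move=> a; elim/Cl_classW=> x; elim/Cl_classW=> y; rewrite !ClE;
   apply/Cl_classP; exact: cliff_scaleDr.
Qed.

Lemma Cl_scaleDl x a b :
  Cl_scale (a + b) x = Cl_add (Cl_scale a x) (Cl_scale b x).
Proof.
by elim/Cl_classW: x => x; rewrite !ClE; apply/Cl_classP;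
  exact: cliff_scaleDl.
Qed.

Lemma Cl_addN : left_inverse Cl_zero Cl_opp Cl_add.
Proof.
move=> x; rewrite /Cl_opp -[X in Cl_add _ X]Cl_scale1 -Cl_scaleDl addNr.
by elim/Cl_classW: x => x; rewrite !ClE; apply/Cl_classP; exact: cliff_scale0.
Qed.

Lemma Cl_mulA : associative Cl_mul.
Proof.
by elim/Cl_classW=> x; elim/Cl_classW=> y; elim/Cl_classW=> z; rewrite !ClE;
   apply/Cl_classP; exact: cliff_mulA.
Qed.

Lemma Cl_mul1l : left_id Cl_one Cl_mul.
Proof.
by elim/Cl_classW=> x; rewrite !ClE; apply/Cl_classP;
  exact: cliff_mul1l.
Qed.

Lemma Cl_mul1r : right_id Cl_one Cl_mul.
Proof.
by elim/Cl_classW=> x; rewrite !ClE; apply/Cl_classP;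
  exact: cliff_mul1r.
Qed.

Lemma Cl_mulDl : left_distributive Cl_mul Cl_add.
Proof.
by elim/Cl_classW=> x; elim/Cl_classW=> y; elim/Cl_classW=> z; rewrite !ClE;
   apply/Cl_classP; exact: cliff_mulDl.
Qed.

Lemma Cl_mulDr : right_distributive Cl_mul Cl_add.
Proof.
by elim/Cl_classW=> x; elim/Cl_classW=> y; elim/Cl_classW=> z; rewrite !ClE;
   apply/Cl_classP; exact: cliff_mulDr.
Qed.

(* algType would require a proof that 1 != 0 in Cl; the ring and module
   structures, with Cl_scalerAl and Cl_scalerAr, are those of an R-algebra. *)
HB.instance Definition _ := GRing.isPzRing.Build Cl Cl_addA Cl_addC Cl_add0
  Cl_addN Cl_mulA Cl_mul1l Cl_mul1r Cl_mulDl Cl_mulDr.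

HB.instance Definition _ := GRing.Zmodule_isLmodule.Build R Cl
  Cl_scaleA Cl_scale1 Cl_scaleDr Cl_scaleDl.

Lemma Cl_scalerAl (a : R) (x y : Cl) : a *: (x * y) = (a *: x) * y.
Proof.
elim/Cl_classW: x => x; elim/Cl_classW: y => y.
by rewrite /GRing.scale /GRing.mul /= !ClE;
   apply/Cl_classP; exact: cliff_scaleAl.
Qed.

Lemma Cl_scalerAr (a : R) (x y : Cl) : a *: (x * y) = x * (a *: y).
Proof.
elim/Cl_classW: x => x; elim/Cl_classW: y => y.
by rewrite /GRing.scale /GRing.mul /= !ClE;
   apply/Cl_classP; exact: cliff_scaleAr.
Qed.

Lemma Cl_gen_is_linear : linear Cl_gen.
Proof.
move=> a Z W.
rewrite -[RHS]/(Cl_add (Cl_scale a (Cl_gen Z)) (Cl_gen W)) /Cl_gen !ClE.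
by apply/Cl_classP; exact: cliff_genP.
Qed.

HB.instance Definition _ :=
  GRing.isLinear.Build R 'rV[R]_(r + s) Cl _ Cl_gen Cl_gen_is_linear.

Lemma Cl_gen_square Z : Cl_gen Z * Cl_gen Z = (- rs_form Z Z) *: (1 : Cl).
Proof.
rewrite -[LHS]/(Cl_mul _ _) -[RHS]/(Cl_scale _ Cl_one) !ClE.
by apply/Cl_classP; exact: cliff_square.
Qed.

End CliffordAlgebra.

Record admissible_module (R : realType) (r s : nat) := AdmissibleModule {
  am_space :> vectType R;
  am_rep : {linear Cl R r s -> 'End(am_space)};
  am_form : {symmetric am_space};
  am_space_neq0 : ({:am_space} != 0)%VS;
  am_rep1 : am_rep 1 = \1%VF;
  am_repM : forall x y, am_rep (x * y) = (am_rep x \o am_rep y)%VF;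
  am_form_nondeg : nondegenerate am_form;
  am_form_skew : forall (Z : 'rV[R]_(r + s)) (v w : am_space),
    am_form (am_rep (Cl_gen Z) v) w = - am_form v (am_rep (Cl_gen Z) w)
}.

Definition minimal_admissible (R : realType) (r s : nat)
    (V : admissible_module R r s) : Prop :=
  forall W : admissible_module R r s, (\dim {:V} <= \dim {:W})%N.

Definition posdef_form (R : realType) (r s : nat)
    (V : admissible_module R r s) : Prop :=
  forall v : V, v != 0 -> 0 < am_form V v v.

(* V is a choice of v_{r,s}. *)
Definition is_v_rs (R : realType) (r s : nat)
    (V : admissible_module R r s) : Prop :=
  minimal_admissible V /\ (s = 0%N -> posdef_form V).

Record lieAlgebra (R : realType) := LieAlgebra {
  lie_space :> lmodType R;
  lie_bracket : {bilinear lie_space -> lie_space -> lie_space};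
  lie_alternating : forall x, lie_bracket x x = 0;
  lie_jacobi : forall x y z,
    lie_bracket x (lie_bracket y z) + lie_bracket y (lie_bracket z x)
    + lie_bracket z (lie_bracket x y) = 0
}.

Definition lie_isomorphic (R : realType) (L M : lieAlgebra R) : Prop :=
  exists f : {linear L -> M}, bijective f /\
    forall x y, f (lie_bracket L x y) = lie_bracket M (f x) (f y).

Section PseudoHType.
Variables (R : realType) (r s : nat) (V : admissible_module R r s).

Local Notation J Z := (am_rep V (Cl_gen Z)).

(* The coordinates of [v, w] are obtained by pairing it with the standard basis
   of R^{r,s}; htype_bracketP and htype_bracket_unique state that this is the
   bracket determined by <J_Z v, w> = <Z, [v, w]>_{r,s}. *)
Definition htype_bracket (v w : V) : 'rV[R]_(r + s) :=
  row_mx (\row_(i < r) am_form V (J (delta_mx 0 (lshift s i)) v) w)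
         (\row_(j < s) - am_form V (J (delta_mx 0 (rshift r j)) v) w).

Lemma htype_bracketP (Z : 'rV[R]_(r + s)) (v w : V) :
  am_form V (J Z v) w = rs_form Z (htype_bracket v w).
Proof.
have JD : {morph (fun Z => am_form V (J Z v) w) : X Y / X + Y}.
  by move=> X Y; rewrite /= !linearD /= add_lfunE linearDl.
have J0 : am_form V (J 0 v) w = 0 by rewrite !linear0 zero_lfunE linear0l.
have JZ a X : am_form V (J (a *: X) v) w = a * am_form V (J X v) w.
  by rewrite !linearZ /= scale_lfunE linearZl_LR.
rewrite {1}(row_sum_delta Z) (big_morph _ JD J0) big_split_ord /= /rs_form.
rewrite -sumrN; congr (_ + _); apply: eq_bigr => i _; rewrite JZ /htype_bracket.
  by rewrite row_mxEl mxE.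
by rewrite row_mxEr mxE mulrN opprK.
Qed.

Lemma htype_bracket_unique (b : V -> V -> 'rV[R]_(r + s)) :
  (forall Z v w, am_form V (J Z v) w = rs_form Z (b v w)) ->
  forall v w, b v w = htype_bracket v w.
Proof.
move=> bP v w.
have deltaE (k l : 'I_(r + s)) :
    (delta_mx 0 k : 'rV[R]_(r + s)) 0 l = (l == k)%:R.
  by rewrite mxE eqxx.
apply/rowP=> k; rewrite -(splitK k); case: (split k) => i /=.
- rewrite /htype_bracket row_mxEl mxE bP /rs_form.
  rewrite (bigD1 i) //= deltaE eqxx mul1r !big1 ?addr0 ?subr0 // => j.
    by rewrite deltaE eq_rlshift mul0r.
  by rewrite deltaE (inj_eq (@lshift_inj _ _)) => /negPf ->; rewrite mul0r.
- rewrite /htype_bracket row_mxEr mxE bP /rs_form.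
  rewrite [X in _ - X](bigD1 i) //= deltaE eqxx mul1r !big1
    ?addr0 ?sub0r ?opprK //.
    move=> j; rewrite deltaE (inj_eq (@rshift_inj _ _)) => /negPf ->.
    by rewrite mul0r.
  by move=> j _; rewrite deltaE eq_lrshift mul0r.
Qed.

Lemma htype_bracket_bilinear : bilinear_for *:%R *:%R htype_bracket.
Proof.
split=> [w a v v'|v a w w']; apply/rowP=> k; rewrite -(splitK k);
  case: (split k) => i /=; rewrite !(row_mxEl, row_mxEr, mxE) /=.
- by rewrite linearP linearPl.
- by rewrite linearP linearPl opprD mulrN.
- by rewrite linearP.
- by rewrite linearP opprD mulrN.
Qed.

Lemma htype_bracketvv v : htype_bracket v v = 0.
Proof.
have Jvv Z : am_form V (J Z v) v = 0.
  have sym : am_form V (J Z v) v = am_form V v (J Z v).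
    by rewrite hermitian_subproof /= expr0 mul1r.
  by apply/eqP; rewrite -eqNr {1}sym -am_form_skew.
apply/rowP=> k; rewrite -(splitK k).
by case: (split k) => i; rewrite !(row_mxEl, row_mxEr, mxE) Jvv ?oppr0.
Qed.

(* The bracket of n = v (+) R^{r,s}, in which R^{r,s} is central. *)
Definition htype_lie_bracket (x y : V * 'rV[R]_(r + s)) : V * 'rV[R]_(r + s) :=
  (0, htype_bracket x.1 y.1).

Lemma htype_lie_bracket_bilinear : bilinear_for *:%R *:%R htype_lie_bracket.
Proof.
have [Bl Br] := htype_bracket_bilinear.
by split=> [y a x x'|x a y y']; apply/eqP;
   rewrite -pair_eqE /pair_eq /= ?Bl ?Br scaler0 addr0 !eqxx.
Qed.

HB.instance Definition _ := bilinear_isBilinear.Build R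
  (V * 'rV[R]_(r + s))%type (V * 'rV[R]_(r + s))%type (V * 'rV[R]_(r + s))%type
  _ _ htype_lie_bracket htype_lie_bracket_bilinear.

Lemma htype_lie_alternating x : htype_lie_bracket x x = 0.
Proof. by rewrite /htype_lie_bracket htype_bracketvv. Qed.

Lemma htype_lie_jacobi x y z :
  htype_lie_bracket x (htype_lie_bracket y z)
  + htype_lie_bracket y (htype_lie_bracket z x)
  + htype_lie_bracket z (htype_lie_bracket x y) = 0.
Proof.
have H0 a b c : htype_lie_bracket a (htype_lie_bracket b c) = 0.
  rewrite /htype_lie_bracket /=; congr (_, _).
  have [_ /(_ a.1 (-1) 0 0)] := htype_bracket_bilinear.
  by rewrite /= scaler0 addr0 scaleN1r addNr.
by rewrite !H0 !addr0.
Qed.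

Definition pseudoH_lie : lieAlgebra R :=
  LieAlgebra htype_lie_alternating htype_lie_jacobi.

End PseudoHType.

(* Main.v *)
Require Import Defs.
From HB Require Import structures.
From mathcomp Require Import all_boot all_order all_algebra.
From mathcomp Require Import reals.
From mathcomp Require Import lra.

(** Call a Lie algebra fat when [x, n] is the whole center for every
    non-central x; this is invariant under Lie algebra isomorphisms.

    The Clifford relation and the skew-symmetry of the operators J_Z give
    [v, J_Z v] = <v, v> Z (htype_bracket_J).  When the scalar product of the
    module is positive definite, [v, -] is therefore onto R^{r,s} for every
    v <> 0, so that n_{r,0} is fat.  An isomorphism from n_{r,0} to n_{t,u} then
    restricts to a linear bijection between the centers R^r and R^{t,u}
    (htype_iso_center_inj, htype_iso_center_surj), hence r = t + u, and n_{t,u}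
    is fat as well (htype_iso_bracket_surj).

    If t and u are both positive, R^{t,u} has a vector Z <> 0 with <Z, Z> = 0.
    Then J_Z squares to 0, so it kills some w <> 0 (J_isotropic_kernel), and
    <Z, [w, w']> = <J_Z w, w'> = 0 for all w': the image of [w, -] lies in the
    proper subspace orthogonal to Z and n_{t,u} is not fat.  So t = 0 or u = 0. *)

Set Implicit Arguments.
Unset Strict Implicit.
Unset Printing Implicit Defensive.

Import Order.TTheory GRing.Theory Num.Theory.

Local Open Scope ring_scope.

(** * The indefinite form on R^{r,s} *)

Section RsForm.
Variables (R : realType) (r s : nat).
Implicit Types Z W X : 'rV[R]_(r + s).

Lemma rs_formC Z W : rs_form Z W = rs_form W Z.
Proof.
by rewrite /rs_form; congr (_ - _); apply: eq_bigr => i _; rewrite mulrC.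
Qed.

Lemma rs_formDl Z W X : rs_form (Z + W) X = rs_form Z X + rs_form W X.
Proof.
rewrite /rs_form addrACA -opprD -!big_split /=.
by congr (_ - _); apply: eq_bigr => i _; rewrite mxE mulrDl.
Qed.

Lemma rs_formDr Z W X : rs_form X (Z + W) = rs_form X Z + rs_form X W.
Proof. by rewrite rs_formC rs_formDl !(rs_formC X). Qed.

Lemma rs_form0r X : rs_form X 0 = 0.
Proof. by apply: (addIr (rs_form X 0)); rewrite -rs_formDr addr0 add0r. Qed.

Lemma rs_form_deltal (i : 'I_r) W :
  rs_form (delta_mx 0 (lshift s i)) W = W 0 (lshift s i).
Proof.
rewrite /rs_form (bigD1 i) //= mxE !eqxx mul1r !big1 ?addr0 ?subr0 // => j.
  by rewrite mxE eqxx eq_rlshift mul0r.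
by rewrite mxE eqxx (inj_eq (@lshift_inj _ _)) => /negPf ->; rewrite mul0r.
Qed.

Lemma rs_form_deltar (j : 'I_s) W :
  rs_form (delta_mx 0 (rshift r j)) W = - W 0 (rshift r j).
Proof.
rewrite /rs_form [X in _ - X](bigD1 j) //= mxE !eqxx mul1r !big1 ?sub0r ?addr0 //.
  by move=> i; rewrite mxE eqxx (inj_eq (@rshift_inj _ _)) => /negPf ->;
     rewrite mul0r.
by move=> i _; rewrite mxE eqxx eq_lrshift mul0r.
Qed.

Lemma rs_form_inj W X : (forall Z, rs_form Z W = rs_form Z X) -> W = X.
Proof.
move=> WX; apply/rowP=> k; rewrite -(splitK k); case: (split k) => i /=.
  by rewrite -!rs_form_deltal.
by apply: oppr_inj; rewrite -!rs_form_deltar.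
Qed.

(** The sum of a positive and a negative unit basis vector is isotropic. *)
Lemma rs_form_isotropic :
  (0 < r)%N -> (0 < s)%N -> exists2 Z : 'rV[R]_(r + s), Z != 0 & rs_form Z Z = 0.
Proof.
move=> r0 s0; pose i := Ordinal r0; pose j := Ordinal s0.
exists (delta_mx 0 (lshift s i) + delta_mx 0 (rshift r j)).
  apply/eqP=> /rowP/(_ (lshift s i)).
  by rewrite !mxE !eqxx eq_lrshift addr0; apply/eqP; rewrite oner_eq0.
rewrite rs_formDl rs_form_deltal rs_form_deltar !mxE !eqxx eq_lrshift eq_rlshift.
by rewrite add0r addr0 subrr.
Qed.

End RsForm.

(** * Clifford multiplication and the bracket *)

Section Module.
Variables (R : realType) (r s : nat) (V : admissible_module R r s).
Implicit Types (Z W : 'rV[R]_(r + s)) (v w : V).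

Local Notation J Z := (am_rep V (Cl_gen Z)).

Lemma J_square Z v : J Z (J Z v) = - rs_form Z Z *: v.
Proof.
by rewrite -comp_lfunE -am_repM Cl_gen_square linearZ am_rep1 /=
  scale_lfunE id_lfunE.
Qed.

Lemma am_formC v w : am_form V v w = am_form V w v.
Proof. by rewrite hermitian_subproof /= expr0 mul1r. Qed.

(** For Z = W this is skew-symmetry and the Clifford relation; both sides are
    symmetric and bilinear in Z and W, so the general case is its
    polarization. *)
Lemma am_form_JJ Z W v :
  am_form V (J Z v) (J W v) = rs_form Z W * am_form V v v.
Proof.
have diag X : am_form V (J X v) (J X v) = rs_form X X * am_form V v v.
  by rewrite am_form_skew J_square linearZ /= mulNr opprK.
have := diag (Z + W).
rewrite !linearD /= !add_lfunE linearDl !linearD /= !diag rs_formDl !rs_formDr.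
rewrite (am_formC (J W v)) (rs_formC W).
lra.
Qed.

Lemma htype_bracket_J Z v :
  htype_bracket v (J Z v) = am_form V v v *: Z.
Proof.
apply: rs_form_inj => W; rewrite -htype_bracketP am_form_JJ mulrC.
rewrite ![rs_form W _]rs_formC /rs_form mulrBr !mulr_sumr.
by congr (_ - _); apply: eq_bigr => i _; rewrite mxE mulrA.
Qed.

Lemma htype_bracket0l w : htype_bracket (V := V) 0 w = 0.
Proof.
have [/(_ w (-1) 0 0) + _] := htype_bracket_bilinear V.
by rewrite /= scaler0 addr0 scaleN1r addNr.
Qed.

Lemma htype_bracket_surj v Z :
  posdef_form V -> v != 0 -> exists w, htype_bracket v w = Z.
Proof.
move=> pos v0; exists (J ((am_form V v v)^-1 *: Z) v).
by rewrite htype_bracket_J scalerA mulfV ?scale1r // gt_eqF // pos.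
Qed.

(** An isotropic Z gives a nilpotent J_Z, which has a kernel because the module
    is non-zero. *)
Lemma J_isotropic_kernel Z : rs_form Z Z = 0 -> exists2 w, w != 0 & J Z w = 0.
Proof.
move=> Z0; have v0 : vpick {:V} != 0 by rewrite vpick0 am_space_neq0.
have [Jv0|Jv0] := eqVneq (J Z (vpick {:V})) 0; first by exists (vpick {:V}).
by exists (J Z (vpick {:V})) => //; rewrite J_square Z0 oppr0 scale0r.
Qed.

End Module.

(** * Isomorphisms and centers *)

Lemma leq_rV_surj (F : fieldType) (m n : nat)
    (g : {linear 'rV[F]_m -> 'rV[F]_n}) :
  (forall w, exists v, g v = w) -> (n <= m)%N.
Proof.
move=> gsurj; have : row_full (lin1_mx g).
  rewrite -sub1mx; apply/row_subP=> i; apply/submxP.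
  by have [v gv] := gsurj (row i 1%:M); exists v; rewrite mul_rV_lin1.
by move/eqP<-; exact: rank_leq_row.
Qed.

Lemma leq_rV_inj (F : fieldType) (m n : nat)
    (g : {linear 'rV[F]_m -> 'rV[F]_n}) :
  injective g -> (m <= n)%N.
Proof.
move=> ginj; have : row_free (lin1_mx g).
  apply: inj_row_free => v; rewrite mul_rV_lin1 => gv0.
  by apply: ginj; rewrite gv0 linear0.
by move/eqP<-; exact: rank_leq_col.
Qed.

Section Isomorphism.
Variables (R : realType) (r s t u : nat).
Variables (V : admissible_module R r s) (W : admissible_module R t u).
Variable f : {linear pseudoH_lie V -> pseudoH_lie W}.
Hypotheses (fbij : bijective f)
  (fM : forall x y,
     f (lie_bracket (pseudoH_lie V) x y)
     = lie_bracket (pseudoH_lie W) (f x) (f y))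
  (posV : posdef_form V).

(** Every (0, Z) is a bracket, since V is non-zero and [v, -] is onto for
    v <> 0. *)
Lemma htype_iso_center_sub Z : (f (0, Z)).1 = 0.
Proof.
have v0 : vpick {:V} != 0 by rewrite vpick0 am_space_neq0.
have [w <-] := htype_bracket_surj Z posV v0.
by have -> := fM (vpick {:V}, 0) (w, 0).
Qed.

(** The preimage of a central element is central, and a central element of
    the Lie algebra of V has no component in V as soon as R^{r,s} is non-zero. *)
Lemma htype_iso_center_preim x :
  (0 < r + s)%N -> (f x).1 = 0 -> x.1 = 0.
Proof.
move=> rs0 fx0; apply/eqP/negPn/negP=> x0.
pose Z := const_mx 1 : 'rV[R]_(r + s).
have [w xw] := htype_bracket_surj Z posV x0.
have : f (0, Z) = 0.
  rewrite -xw; have -> := fM x (w, 0).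
  by rewrite /= /htype_lie_bracket fx0 htype_bracket0l.
rewrite -[RHS](linear0 f) => /(bij_inj fbij) [] /rowP/(_ (Ordinal rs0)).
by rewrite !mxE; apply/eqP; rewrite oner_eq0.
Qed.

Definition htype_iso_center Z : 'rV[R]_(t + u) := (f (0, Z)).2.

Lemma htype_iso_center_linear : linear htype_iso_center.
Proof.
move=> a X Y; rewrite /htype_iso_center.
have -> : (0, a *: X + Y) = a *: (0, X) + (0, Y) :> pseudoH_lie V.
  by congr (_, _); rewrite /= scaler0 addr0.
by rewrite linearP.
Qed.

HB.instance Definition _ :=
  GRing.isLinear.Build R 'rV[R]_(r + s) 'rV[R]_(t + u) _ htype_iso_center
    htype_iso_center_linear.

Lemma htype_iso_centerE Z : f (0, Z) = (0, htype_iso_center Z).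
Proof. by rewrite [LHS]surjective_pairing htype_iso_center_sub. Qed.

Lemma htype_iso_center_inj : injective htype_iso_center.
Proof.
move=> X Y XY; have : f (0, X) = f (0, Y) by rewrite !htype_iso_centerE XY.
by move/(bij_inj fbij) => [].
Qed.

Lemma htype_iso_center_surj Y :
  (0 < r + s)%N -> exists Z, htype_iso_center Z = Y.
Proof.
move=> rs0; have [g _ gK] := fbij.
have := @htype_iso_center_preim (g (0, Y)) rs0; rewrite gK => /(_ erefl) g0.
exists (g (0, Y)).2; rewrite /htype_iso_center -g0.
by rewrite -[X in f X]surjective_pairing gK.
Qed.

Lemma htype_iso_dim_center : (0 < r + s)%N -> (r + s = t + u)%N.
Proof.
move=> rs0; apply/eqP; rewrite eqn_leq (leq_rV_inj htype_iso_center_inj) /=.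
by apply: leq_rV_surj => Y; exact: htype_iso_center_surj.
Qed.

(** The preimage of (w, 0) has a non-zero component in V, because f sends
    (0, Z) into the center; its brackets are all (0, Z), and f maps these onto
    all (0, Y). *)
Lemma htype_iso_bracket_surj w Y :
  (0 < r + s)%N -> w != 0 -> exists w', htype_bracket (V := W) w w' = Y.
Proof.
move=> rs0 w0; have [g _ gK] := fbij.
have gw0 : (g (w, 0)).1 != 0.
  apply: contraNneq w0 => gw0.
  have : (f (g (w, 0))).1 = 0.
    by rewrite [g _]surjective_pairing gw0 htype_iso_center_sub.
  by rewrite gK => /= ->.
have [Z <-] := htype_iso_center_surj Y rs0.
have [v' gwv'] := htype_bracket_surj Z posV gw0.
exists (f (v', 0)).1; have := fM (g (w, 0)) (v', 0).
by rewrite gK /= /htype_lie_bracket /= gwv' htype_iso_centerE => -[].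
Qed.

(** For isotropic Z <> 0, J_Z kills some w <> 0, and then the image of [w, -]
    lies in the hyperplane orthogonal to Z. *)
Lemma htype_iso_definite : (0 < r + s)%N -> t = 0%N \/ u = 0%N.
Proof.
move=> rs0; case: (posnP t) => [|t0]; first by left.
case: (posnP u) => [|u0]; first by right.
have [Z /eqP Z0 ZZ0] := rs_form_isotropic R t0 u0.
have [w w0 Jw0] := J_isotropic_kernel W ZZ0.
case: Z0; apply: rs_form_inj => Y.
have [w' <-] := htype_iso_bracket_surj Y rs0 w0.
by rewrite rs_formC -htype_bracketP Jw0 linear0l rs_form0r.
Qed.

End Isomorphism.

Theorem theorem3p2 (R : realType) (r t u : nat)
    (V : admissible_module R r 0) (W : admissible_module R t u) :
  (1 <= r)%N -> (1 <= t + u)%N ->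
  is_v_rs V -> is_v_rs W ->
  lie_isomorphic (pseudoH_lie V) (pseudoH_lie W) ->
  (t, u) = (r, 0%N) \/ (t, u) = (0%N, r).
Proof.
move=> r0 _ [_ /(_ erefl) posV] _ [f [fbij fM]].
have rs0 : (0 < r + 0)%N by rewrite addn0.
have := htype_iso_dim_center fbij fM posV rs0; rewrite addn0 => ->.
have [->|->] := htype_iso_definite fbij fM posV rs0.
  by right.
by left; rewrite addn0.
Qed.
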